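(* Let $R=\{k\epsilon+n\sigma_1: k\in\{0,\pm1\},\ n\in\mathbb{Z}\}$ be the affine root system of type $A_1$ (nullity $\nu=1$). Then any root basis for $R$ is a classic root basis for $R$.
   Context: Let $A$ be a free abelian group of rank $2$ with $\mathbb{Z}$-basis $\{\epsilon,\sigma_1\}$ and the symmetric positive semidefinite form determined by $(\epsilon,\epsilon)=2$ and $\sigma_1$ in the radical, so that the radical is $\Lambda=\mathbb{Z}\sigma_1$. The isotropic roots of $R$ are the elements $n\sigma_1$; such a root is strictly positive if $n\geq 0$ and it is nonzero. In nullity 1, the non-isotropic roots are $R^\times=\pm\epsilon+\mathbb{Z}\sigma_1$. Root basis: a $\mathbb{Z}$-basis $\Pi=\{\beta_0,\beta_1\}$ of $A$ contained in $R^\times$ such that every strictly positive isotropic root $\sigma\in R$ can be written $\sigma=m_0\beta_0+m_1\beta_1$ with $m_0,m_1\ge0$. (The paper's general definition requires $\Pi$ to lie in $R_b^\times$, where $R_b$ is the baby root system; for $\nu=1$ one has $R_b=R$.) Classic root basis: a $\mathbb{Z}$-basis $\Pi=\{\beta_0,\beta_1\}\subseteq R$ of $A$ such that every root $\alpha\in R$ can be written $\alpha=\pm(n_0\beta_0+n_1\beta_1)$ with $n_0,n_1\in\mathbb{Z}_{\ge0}$. *)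

(* Defs.v *)
From mathcomp Require Import all_boot all_order all_algebra.
Set Implicit Arguments.
Unset Strict Implicit.
Unset Printing Implicit Defensive.
Import Order.TTheory GRing.Theory Num.Theory.
Local Open Scope ring_scope.

Definition zbasis2 (A : zmodType) (a b : A) : Prop :=
  forall x : A, exists! c : int * int, x = a *~ c.1 + b *~ c.2.

(* Additivity in the second argument follows from symmetry. The form takes
   integer values because (eps, eps) = 2 and sigma1 is in the radical. *)
Record A1_form (A : zmodType) (eps sigma1 : A) (form : A -> A -> int) : Prop :=
  A1Form {
    A1_form_addl : forall x y z, form (x + y) z = form x z + form y z;
    A1_form_sym : forall x y, form x y = form y x;
    A1_form_psd : forall x, 0 <= form x x;
    A1_form_eps : form eps eps = 2;
    A1_form_radical : forall x, form sigma1 x = 0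
  }.

(* 0 counts as a root, and it is isotropic. *)
Definition A1_root (A : zmodType) (eps sigma1 : A) (alpha : A) : Prop :=
  exists k n : int, k \in [:: 0; 1; -1] /\ alpha = eps *~ k + sigma1 *~ n.

Definition isotropic_root (A : zmodType) (eps sigma1 : A)
    (form : A -> A -> int) (alpha : A) : Prop :=
  A1_root eps sigma1 alpha /\ form alpha alpha = 0.

Definition nonisotropic_root (A : zmodType) (eps sigma1 : A)
    (form : A -> A -> int) (alpha : A) : Prop :=
  A1_root eps sigma1 alpha /\ form alpha alpha <> 0.

Definition strictly_positive_isotropic (A : zmodType) (eps sigma1 : A)
    (form : A -> A -> int) (sigma : A) : Prop :=
  [/\ isotropic_root eps sigma1 form sigma,
      exists n : int, 0 <= n /\ sigma = sigma1 *~ n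
    & sigma <> 0].

(* In nullity 1 the baby root system is the whole root system, so beta0 and beta1
   range over all non-isotropic roots. *)
Definition root_basis (A : zmodType) (eps sigma1 : A)
    (form : A -> A -> int) (beta0 beta1 : A) : Prop :=
  [/\ zbasis2 beta0 beta1,
      nonisotropic_root eps sigma1 form beta0,
      nonisotropic_root eps sigma1 form beta1
    & forall sigma, strictly_positive_isotropic eps sigma1 form sigma ->
        exists m0 m1 : nat, sigma = beta0 *+ m0 + beta1 *+ m1].

Definition classic_root_basis (A : zmodType) (eps sigma1 : A)
    (beta0 beta1 : A) : Prop :=
  [/\ zbasis2 beta0 beta1,
      A1_root eps sigma1 beta0,
      A1_root eps sigma1 beta1
    & forall alpha, A1_root eps sigma1 alpha ->
        exists n0 n1 : nat,
          alpha = beta0 *+ n0 + beta1 *+ n1 \/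
          alpha = - (beta0 *+ n0 + beta1 *+ n1)].

(* Main.v *)
Require Import Defs.
From mathcomp Require Import all_boot all_order all_algebra.
From mathcomp Require Import zify ring.

(** Everything follows from the single relation [sigma1 = beta0 + beta1].

    A non-isotropic root has [eps]-coordinate 1 or -1, because multiples of
    [sigma1] have norm zero.  Write [beta_i = k_i eps + n_i sigma1]
    accordingly.  The root [sigma1] is isotropic and strictly positive, so it
    equals [m0 beta0 + m1 beta1] with [m0, m1 >= 0].  Comparing
    [eps]-coordinates, [m0 k0 + m1 k1 = 0] forces [k1 = - k0] and [m0 = m1];
    comparing [sigma1]-coordinates, [m0 (n0 + n1) = 1] forces [m0 = 1]
    (lemma [root_basis_coords]).

    Hence [eps = k0 (beta0 - n0 (beta0 + beta1))], and a root [k eps + n sigma1]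
    has the form [(c + j) beta0 + j beta1] with [c = k k0] in [{0, 1, -1}].
    The coordinates are integers differing by at most one, so they cannot have
    strictly opposite signs. *)

Set Implicit Arguments.
Unset Strict Implicit.
Unset Printing Implicit Defensive.
Import Order.TTheory GRing.Theory Num.Theory.
Local Open Scope ring_scope.

Lemma zbasis2_inj (A : zmodType) (a b : A) (i j i' j' : int) :
  zbasis2 a b -> a *~ i + b *~ j = a *~ i' + b *~ j' -> i = i' /\ j = j'.
Proof.
move=> basis_ab eq_comb.
have [c [_ uniq_c]] := basis_ab (a *~ i + b *~ j).
have := uniq_c (i', j') eq_comb; rewrite (uniq_c (i, j) erefl).
by case=> -> ->.
Qed.

Lemma A1_form_mulz_radical (A : zmodType) (eps sigma1 : A)
    (form : A -> A -> int) (n : int) (x : A) :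
  A1_form eps sigma1 form -> form (sigma1 *~ n) x = 0.
Proof.
move=> formA; have addl := A1_form_addl formA.
have form0 : form 0 x = 0 by have := addl 0 0 x; rewrite addr0; lia.
have formN y : form (- y) x = - form y x.
  by have := addl y (- y) x; rewrite subrr form0; lia.
have formMn m : form (sigma1 *+ m) x = 0.
  elim: m => [|m IHm]; first by rewrite mulr0n.
  by rewrite mulrS addl (A1_form_radical formA) IHm.
by case: n => m; rewrite ?NegzE ?mulrNz ?formN -pmulrn formMn.
Qed.

Lemma nonisotropic_root_coords (A : zmodType) (eps sigma1 : A)
    (form : A -> A -> int) (beta : A) :
  A1_form eps sigma1 form -> nonisotropic_root eps sigma1 form beta ->
  exists k n : int, (k = 1 \/ k = -1) /\ beta = eps *~ k + sigma1 *~ n.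
Proof.
move=> formA [[k [n [k_range ->]]] form_neq0]; exists k, n; split=> //.
move: k_range; rewrite !inE => /or3P[] /eqP k_eq; [|by left|by right].
by case: form_neq0; rewrite k_eq mulr0z add0r (A1_form_mulz_radical _ _ formA).
Qed.

Lemma basis_radical_strictly_positive (A : zmodType) (eps sigma1 : A)
    (form : A -> A -> int) :
  zbasis2 eps sigma1 -> A1_form eps sigma1 form ->
  strictly_positive_isotropic eps sigma1 form sigma1.
Proof.
move=> basisA formA; split; last 1 first.
- move=> sigma_eq0.
  have [] // := zbasis2_inj (i := 0) (j := 1) (i' := 0) (j' := 0) basisA.
  by rewrite sigma_eq0 !mul0rz.
- split; last exact: (A1_form_radical formA).
  by exists 0, 1; split; rewrite ?inE // mulr0z add0r mulr1z.
- by exists 1; rewrite mulr1z.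
Qed.

(** The simple roots have opposite finite parts and sum to the generator of
    the radical: this is where the positivity condition is spent. *)
Lemma root_basis_coords (A : zmodType) (eps sigma1 : A)
    (form : A -> A -> int) (beta0 beta1 : A) :
  zbasis2 eps sigma1 -> A1_form eps sigma1 form ->
  root_basis eps sigma1 form beta0 beta1 ->
  exists k n : int, [/\ k = 1 \/ k = -1, beta0 = eps *~ k + sigma1 *~ n
                      & sigma1 = beta0 + beta1].
Proof.
move=> basisA formA [_ noniso0 noniso1 pos_iso].
have [k0 [n0 [k0_sign beta0E]]] := nonisotropic_root_coords formA noniso0.
have [k1 [n1 [k1_sign beta1E]]] := nonisotropic_root_coords formA noniso1.
have [m0 [m1 sigmaE]] :=
  pos_iso _ (basis_radical_strictly_positive basisA formA).
have [coord_eps coord_sigma] : 0 = k0 * m0 + k1 * m1 /\ 1 = n0 * m0 + n1 * m1.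
  apply: (zbasis2_inj basisA); rewrite mulr0z add0r mulr1z {1}sigmaE.
  by rewrite !pmulrn beta0E beta1E !mulrzDl -!mulrzA !mulrzDr addrACA.
have m01 : m0 = m1.
  by case: k0_sign k1_sign coord_eps => -> [] ->; lia.
have m0_eq1 : m0 = 1%N.
  have /(congr1 absz)/eqP : (n0 + n1) * m0%:Z = 1.
    by rewrite mulrDl coord_sigma m01.
  by rewrite abszM muln_eq1 => /andP[_ /eqP].
by exists k0, n0; split=> //; rewrite sigmaE -m01 m0_eq1.
Qed.

Lemma same_sign_comb (A : zmodType) (a b : A) (i j : int) :
  0 <= i /\ 0 <= j \/ i <= 0 /\ j <= 0 ->
  exists n0 n1 : nat, a *~ i + b *~ j = a *+ n0 + b *+ n1 \/
                      a *~ i + b *~ j = - (a *+ n0 + b *+ n1).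
Proof.
move=> same_sign; exists `|i|%N, `|j|%N.
case: same_sign => -[i_sign j_sign]; [left | right].
  by rewrite !pmulrn !gez0_abs.
by rewrite !pmulrn !lez0_abs // !mulrNz -opprD opprK.
Qed.

Theorem lemma4p3 (A : zmodType) (eps sigma1 : A) (form : A -> A -> int)
    (basisA : zbasis2 eps sigma1) (formA : A1_form eps sigma1 form)
    (beta0 beta1 : A) :
  root_basis eps sigma1 form beta0 beta1 ->
  classic_root_basis eps sigma1 beta0 beta1.
Proof.
move=> rootB; have [basisB [root0 _] [root1 _] _] := rootB.
split=> // _ [k [n [k_range ->]]].
have [k0 [n0 [k0_sign beta0E sigmaE]]] := root_basis_coords basisA formA rootB.
pose j := n - k * k0 * n0.
have -> : eps *~ k + sigma1 *~ n = beta0 *~ (k * k0 + j) + beta1 *~ j.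
  (* regroup the right-hand side as (k k0) beta0 + j sigma1 *)
  rewrite mulrzDr -addrA -mulrzDl -sigmaE beta0E mulrzDl -!mulrzA -addrA.
  rewrite -mulrzDr; congr (_ *~ _ + _ *~ _); rewrite /j; last by ring.
  by case: k0_sign => ->; ring.
apply: same_sign_comb.
have : k * k0 \in [:: 0; 1; -1].
  by move: k_range; rewrite !inE; case: k0_sign => -> /or3P[] /eqP->.
by rewrite !inE => /or3P[] /eqP->; lia.
Qed.
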